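(* Assume the non-lattice case. The measure $\rho$ on $C$ given by $$\rho(dx)=\left(\int_{[0,\infty)}\mu\bigl((x,x+y]\bigr)\,\mu(dy)\right)dx$$ (which is an invariant measure of the process of reflections) has finite mass if and only if $$\int_{[0,\infty)}\bigl(1-F_\mu(x)\bigr)^2\,dx<\infty .$$ This holds, in particular, when $\mathsf{E}\bigl(\sqrt{Y_1}\bigr)=\int_{[0,\infty)}\sqrt{x}\,\mu(dx)<\infty$.
   Context: Let $(Y_n)_{n\ge 1}$ be i.i.d. non-constant, non-negative real random variables with common distribution $\mu$ and distribution function $F_\mu(x)=\mu([0,x])$. Non-lattice case: there is no $\kappa>0$ with $\operatorname{supp}(\mu)\subset\kappa\cdot\mathbb{N}_0$, where $\mathbb{N}_0=\{0,1,2,\dots\}$. Let $N=\sup\operatorname{supp}(\mu)$, and $C=[0,N]$ if $N<\infty$, $C=[0,\infty)$ if $N=\infty$; $dx$ is Lebesgue measure. Reflected random walk is the Markov chain $X_{n+1}=|X_n-Y_{n+1}|$ on $C$. Reflection times: $r(0)=0$ and $r(k+1)=\inf\{n>r(k): Y_{r(k)+1}+\dots+Y_n\ge X_{r(k)}\}$. The process of reflections is the Markov chain $R_k=X_{r(k)}$. *)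

(* Defs.v *)
From HB Require Import structures.
From mathcomp Require Import all_boot all_order all_algebra.
From mathcomp Require Import all_classical all_reals all_analysis.
From mathcomp Require Import measurable_realfun.

Set Implicit Arguments.
Unset Strict Implicit.
Unset Printing Implicit Defensive.

Import Order.TTheory GRing.Theory Num.Theory.
Import numFieldNormedType.Exports.

Local Open Scope classical_set_scope.
Local Open Scope ring_scope.

Section IID.
Context {d : measure_display} {T : measurableType d} {R : realType}.
Variables (P : probability T R) (Y : nat -> {RV P >-> measurableTypeR R}).

Definition mutually_independent : Prop :=
  forall (s : seq nat) (A : nat -> set (measurableTypeR R)),
    uniq s -> (forall i, measurable (A i)) ->
    P (\bigcap_(i in [set` s]) (Y i @^-1` A i))
    = (\prod_(i <- s) P (Y i @^-1` A i))%E.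

Definition iid (mu : probability (measurableTypeR R) R) : Prop :=
  mutually_independent /\
  forall n A, measurable A -> distribution P (Y n) A = mu A.

End IID.

Section Law.
Context {R : realType}.
Variable mu : probability (measurableTypeR R) R.

Definition supp : set R := [set x | forall U : set R, open U -> U x -> (0 < mu U)%E].

Definition lattice : Prop :=
  exists2 kappa : R, 0 < kappa & supp `<=` [set kappa * n%:R | n in [set: nat]].

Definition Nsup : \bar R := ereal_sup (EFin @` supp).

(* [0, N] if N is finite, and [0, +oo) if N = +oo *)
Definition state_space : set R := [set x | 0 <= x /\ (x%:E <= Nsup)%E].

Definition Fmu (x : R) : \bar R := mu `[0, x]%classic.

Definition rho_density (x : R) : \bar R :=
  (\int[mu]_(y in `[0%R, +oo[) mu `]x, (x + y)%R]%classic)%E.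

(* The measure on C, seen as a measure on R carried by C = [state_space]. *)
Definition rho (A : set (measurableTypeR R)) : \bar R :=
  (\int[lebesgue_measure]_(x in A `&` state_space) rho_density x)%E.

Lemma rho_density_ge0 x : (0 <= rho_density x)%E.
Proof. by apply: integral_ge0 => y _; exact: measure_ge0. Qed.

Lemma measurable_state_space :
  measurable (state_space : set (measurableTypeR R)).
Proof.
apply: is_interval_measurable => x y [x0 xN] [y0 yN] z /andP[xz zy]; split.
  exact: le_trans x0 xz.
by apply: le_trans yN; rewrite lee_fin.
Qed.

Lemma measurable_rho_density :
  measurable_fun [set: measurableTypeR R] rho_density.
Proof.
pose S := measurableTypeR R.
pose B : set ((S * S) * S) := [set u | u.1.1 < u.2 <= u.1.1 + u.1.2].
have mfst : measurable_fun [set: (S * S) * S] (fun u => u.1.1 : R).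
  exact: measurableT_comp measurable_fst measurable_fst.
have msnd : measurable_fun [set: (S * S) * S] (fun u => u.1.2 : R).
  exact: measurableT_comp measurable_snd measurable_fst.
have mB : measurable B.
  rewrite -[B]setTI.
  apply: (@measurable_and _ _ _ (fun u : (S * S) * S => u.1.1 < u.2)
            (fun u => u.2 <= u.1.1 + u.1.2) _ _ measurableT [set true]) => //.
    by apply: measurable_fun_ltr => //; exact: measurable_snd.
  apply: measurable_fun_ler; first exact: measurable_snd.
  exact: measurable_funD.
have mk : measurable_fun [set: S * S]
    (fun z : S * S => mu `]z.1, (z.1 + z.2)%R]%classic).
  have := measurable_fun_xsection mu mB.
  congr measurable_fun; apply/funext => z /=; congr (mu _).
  by apply/seteqP; split => t; rewrite /xsection /B /= inE/= in_itv.
pose D : set (S * S) := setT `*` `[0%R, +oo[.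
have mD : measurable D by apply: measurableX => //; exact: measurable_itv.
pose f := (fun z : S * S => mu `]z.1, (z.1 + z.2)%R]%classic) \_ D.
have mf : measurable_fun setT f.
  by apply/(measurable_restrictT _ mD); exact: measurable_funTS.
have f0 z : (0 <= f z)%E by apply: erestrict_ge0 => ? _; exact: measure_ge0.
have := @measurable_fun_fubini_tonelli_F _ _ _ _ _ mu f mf f0.
congr measurable_fun; apply/funext => x.
rewrite /fubini_F /rho_density [RHS]integral_mkcond; apply: eq_integral => y _.
by rewrite /f !patchE/= /D in_setX/= in_setT.
Qed.

Let rho0 : rho set0 = 0%E.
Proof. by rewrite /rho set0I integral_set0. Qed.

Let rho_ge0 A : (0 <= rho A)%E.
Proof. by apply: integral_ge0 => x _; exact: rho_density_ge0. Qed.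

Let rho_sigma_additive : semi_sigma_additive rho.
Proof.
move=> F mF tF mUF; rewrite /rho; apply: cvg_toP.
  apply: ereal_nondecreasing_is_cvgn => m n mn.
  by apply: lee_sum_nneg_natr => // k _ _; exact: rho_ge0.
rewrite setI_bigcupl ge0_integral_bigcup//=.
- by move=> k; apply: measurableI => //; exact: measurable_state_space.
- exact: measurable_funTS measurable_rho_density.
- by move=> x _; exact: rho_density_ge0.
- exact: trivIset_setIr.
Qed.

HB.instance Definition _ := isMeasure.Build _ _ _ rho
  rho0 rho_ge0 rho_sigma_additive.

End Law.

Section ReflectedRandomWalk.
Context {R : realType}.

(* The walk and its reflection times along one realization of the increments;
   [y n] stands for Y_{n+1}, so Y_{r+1} + ... + Y_n is
   [\sum_(r <= j < n) y j]. *)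
Variables (y : nat -> R) (x : R).

Fixpoint reflected_walk (n : nat) : R :=
  if n is m.+1 then `|reflected_walk m - y m| else x.

(* [None] is the infimum of the empty set, +oo *)
Definition first_time (Q : pred nat) : option nat :=
  if pselect (exists n, Q n) is left e then Some (ex_minn e) else None.

Fixpoint reflection_time (k : nat) : option nat :=
  if k is j.+1 then
    obind (fun r => first_time (fun n =>
      (r < n)%N && (reflected_walk r <= \sum_(r <= i < n) y i)))
      (reflection_time j)
  else Some 0%N.

Definition reflection_process (k : nat) : option R :=
  omap reflected_walk (reflection_time k).

End ReflectedRandomWalk.

Section Kernel.
Context {d : measure_display} {T : measurableType d} {R : realType}.
Variables (P : probability T R) (Y : nat -> {RV P >-> measurableTypeR R}).

(* One-step transition probability of the Markov chain of reflections: the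
   probability that R_1 is in A when the walk starts at X_0 = R_0 = x. *)
Definition reflection_kernel (x : R) (A : set R) : \bar R :=
  P [set w | exists2 z, reflection_process (fun n => Y n w) x 1 = Some z & A z].

End Kernel.

Definition invariant_measure {R : realType} (C : set R)
    (p : R -> set R -> \bar R)
    (nu : {measure set (measurableTypeR R) -> \bar R}) : Prop :=
  forall A : set (measurableTypeR R), measurable A -> A `<=` C ->
    (\int[nu]_(x in (C : set (measurableTypeR R))) p x A)%E = nu A.

(* Main.v *)
Require Import Defs.
From HB Require Import structures.
From mathcomp Require Import all_boot all_order all_algebra.
From mathcomp Require Import all_classical all_reals all_analysis.
From mathcomp Require Import measurable_realfun.
From mathcomp Require Import ring lra.

Set Implicit Arguments.
Unset Strict Implicit.
Unset Printing Implicit Defensive.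

Import Order.TTheory GRing.Theory Num.Theory.
Import numFieldNormedType.Exports.

Local Open Scope classical_set_scope.
Local Open Scope ring_scope.

(** Write H(x) = mu(]x, +oo[), let S_n be the sum of the first n increments,
    and let h be the density of rho.

    Invariance.  As mu(]x, x + y]) = H(x) - H(x + y), integrating in y gives
    h(x) = H(x) - E H(x + Y), so the sum of E h(S_k + t) over k < n telescopes
    to H(t) - E H(S_n + t).  The remainder tends to 0, because
    E exp(- S_n) = (E exp(- Y))^n and E exp(- Y) < 1 unless Y = 0 almost
    surely.  Hence E h(S_0 + t) + E h(S_1 + t) + ... = H(t)
    ([renewal_identity]).  Started at x > 0, the walk is first reflected at
    the step n + 1 for which S_n < x <= S_(n+1), and then R_1 = S_(n+1) - x; so
    the kernel is a series over n of probabilities about the pair of S_n and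
    the next increment, which are independent ([reflection_kernel_series],
    [next_increment_law]).  In the integral of h(x) p(x, A) dx, the
    substitution s = S_n + Y_(n+1) - x ([integral_first_passage]) and the
    renewal identity at t = y - s leave the integral over s in A of
    P(s < Y < s + Y'), where Y' is an independent copy of Y.  The density
    h(s) is P(s < Y <= s + Y'); for given Y and Y' the two events differ for
    at most one s, so both have the same integral over A ([integral_landing]).

    Mass.  For given nonnegative Y and Y', the sets of x >= 0 such that
    x < Y <= x + Y', respectively such that x < Y and x < Y', are intervals of
    the same length min(Y, Y').  By Tonelli the mass of rho and the integral
    of H^2 are therefore the same number, E min(Y, Y')
    ([rho_state_space], [integral_tail_sq]), and
    min(Y, Y') <= sqrt(Y) sqrt(Y') bounds it by (E sqrt(Y))^2
    ([integral_min_le_sqrt]). *)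

(** * Products of measures and Lebesgue measure *)

Section MeasureTools.
Context {R : realType}.
Local Notation S := (measurableTypeR R).
Local Notation leb := (@lebesgue_measure R).

Lemma measurable_set_of_pred d (T : measurableType d) (b : T -> bool) :
  measurable_fun setT b -> measurable [set x | b x].
Proof.
move=> mb; rewrite -[X in measurable X]setTI.
exact: (mb measurableT [set true]).
Qed.

Lemma measurable_coords :
  [/\ measurable_fun [set: S * (S * S)] (fun u => u.1 : S),
    measurable_fun [set: S * (S * S)] (fun u => u.2.1 : S)
  & measurable_fun [set: S * (S * S)] (fun u => u.2.2 : S)].
Proof.
split; first exact: measurable_fst.
- exact: measurableT_comp measurable_fst measurable_snd.
- exact: measurableT_comp measurable_snd measurable_snd.
Qed.

(** Tonelli for an indicator function: the measure of a set in the product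
    may be computed by slicing along either factor. *)
Lemma measure_section_swap d1 d2 (T1 : measurableType d1)
    (T2 : measurableType d2) (m1 : {sigma_finite_measure set T1 -> \bar R})
    (m2 : {sigma_finite_measure set T2 -> \bar R}) (E : set (T1 * T2)) :
  measurable E ->
  (\int[m1]_x m2 (xsection E x) = \int[m2]_y m1 (ysection E y))%E.
Proof.
move=> mE; have := indic_fubini_tonelli m1 m2 mE.
by rewrite indic_fubini_tonelli_FE// indic_fubini_tonelli_GE.
Qed.

Lemma lebesgue_measure_reflection (c : R) (A : set S) :
  measurable A -> pushforward leb (fun x : S => (c - x : S)) A = leb A.
Proof.
have mf : measurable_fun [set: S] (fun x : S => (c - x : S)).
  by apply: measurable_funB.
pose mixin := isMeasurableFun.Build _ _ _ _ _ mf.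
pose f : {mfun S >-> S} := HB.pack (fun x : S => (c - x : S)) mixin.
move=> mA; apply/esym.
apply: (@lebesgue_measure_unique R (pushforward leb f)) => // _ [[a b] _ <-] /=.
rewrite /pushforward /= (_ : _ @^-1` _ = `[c - b, c - a[%classic); last first.
  apply/seteqP; split => x /=; rewrite !in_itv/= => /andP[? ?].
    by apply/andP; split; lra.
  by apply/andP; split; lra.
by rewrite !lebesgue_measure_itv/= !lte_fin; have -> : (c - b < c - a) = (a < b);
  [lra|case: ifP => // _; rewrite -!EFinD; congr (_%:E); ring].
Qed.

Lemma ge0_integral_reflection (c : R) (f : S -> \bar R) :
  measurable_fun setT f -> (forall x, 0 <= f x)%E ->
  (\int[leb]_x f (c - x)%R = \int[leb]_x f x)%E.
Proof.
move=> mf f0.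
have mg : measurable_fun [set: S] (fun x : S => (c - x : S)).
  by apply: measurable_funB.
rewrite -[LHS](@ge0_integral_pushforward _ _ S S R _ mg leb setT f)//.
by apply: eq_measure_integral => A mA _; exact: lebesgue_measure_reflection.
Qed.

(** The form in which boundary points of a region are disregarded. *)
Lemma lebesgue_measure_add_point (A B : set S) (a : R) :
  measurable A -> measurable B -> A `<=` B -> B `<=` A `|` [set a] ->
  leb A = leb B.
Proof.
move=> mA mB AB BA; apply/eqP; rewrite eq_le le_measure ?inE//=.
have ma : measurable ([set a] : set S) by exact: measurable_set1.
apply: (le_trans (le_measure leb _ _ BA)); rewrite ?inE//.
  exact: measurableU.
rewrite [leLHS](@measureU0 _ _ _ (leb : {measure set S -> \bar R}))//.
exact: lebesgue_measure_set1.
Qed.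

(** A bundled form of the product: unification does not find on the bare
    product the finiteness that the exchange lemma above requires. *)
Definition product_law d1 d2 (T1 : measurableType d1) (T2 : measurableType d2)
  (P1 : probability T1 R) (P2 : probability T2 R) :
  probability (T1 * T2)%type R := (P1 \x P2)%E.

Lemma product_lawE d1 d2 (T1 : measurableType d1) (T2 : measurableType d2)
    (P1 : probability T1 R) (P2 : probability T2 R) (E : set (T1 * T2)) :
  product_law P1 P2 E = (\int[P1]_x P2 (xsection E x))%E.
Proof. by []. Qed.

Lemma integral_product_law d1 d2 (T1 : measurableType d1)
    (T2 : measurableType d2) (P1 : probability T1 R) (P2 : probability T2 R)
    (f : T1 * T2 -> \bar R) :
  measurable_fun setT f -> (forall z, 0 <= f z)%E ->
  (\int[product_law P1 P2]_z f z = \int[P1]_x \int[P2]_y f (x, y))%E.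
Proof. by move=> mf f0; exact: (fubini_tonelli1 f mf f0). Qed.

Lemma integral_probability_cst d (T : measurableType d)
    (P : probability T R) (c : \bar R) : (\int[P]_x c = c)%E.
Proof.
rewrite (eq_integral (cst c))// integral_cst//= -[RHS]mule1.
by congr (_ * _)%E; exact: probability_setT.
Qed.

End MeasureTools.

(** * The tail of the law and the density of rho *)

Section TailOfLaw.
Context {R : realType}.
Local Notation S := (measurableTypeR R).
Variable mu : probability S R.
Hypothesis mu_nneg : mu `]-oo, 0[%classic = 0%E.

Definition tail (x : R) : \bar R := mu `]x, +oo[%classic.

Lemma tail_ge0 x : (0 <= tail x)%E. Proof. exact: measure_ge0. Qed.

Lemma tail_le1 x : (tail x <= 1)%E.
Proof. by apply: probability_le1; exact: measurable_itv. Qed.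

Lemma tail_nonincreasing x y : x <= y -> (tail y <= tail x)%E.
Proof.
move=> xy; rewrite /tail le_measure ?inE//; try exact: measurable_itv.
by move=> z /=; rewrite !in_itv/= !andbT; exact: le_lt_trans.
Qed.

Lemma measurable_tail : measurable_fun [set: S] tail.
Proof.
have mB : measurable [set u : S * S | u.1 < u.2].
  apply: measurable_set_of_pred; apply: measurable_fun_ltr.
    exact: measurable_fst.
  exact: measurable_snd.
have := measurable_fun_xsection mu mB.
congr measurable_fun; apply/funext => x /=; congr (mu _).
by apply/seteqP; split => t; rewrite /xsection /= inE/= in_itv/= andbT.
Qed.

Lemma integral_law_nneg (f : S -> \bar R) :
  measurable_fun setT f -> (forall y, 0 <= f y)%E ->
  (\int[mu]_(y in `[0%R, +oo[) f y = \int[mu]_y f y)%E.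
Proof.
move=> mf f0.
rewrite [RHS](@ge0_negligible_integral _ _ _ mu setT `]-oo, 0[%classic)//.
congr (integral _ _ _); apply/seteqP; split => x /=; rewrite !in_itv/= andbT.
  by move=> x0; split => //; rewrite ltNge x0.
by move=> [_ /negP]; rewrite -leNgt.
Qed.

Lemma prob_nneg : mu `[0, +oo[%classic = 1%E.
Proof.
have := integral_law_nneg (measurable_cst 1%E) (fun=> lee01).
rewrite integral_cst//= integral_cst//= !mul1e => ->.
exact: probability_setT.
Qed.

Lemma tail_split x y : 0 <= y ->
  (tail x = mu `]x, (x + y)%R]%classic + tail (x + y))%E.
Proof.
move=> y0; rewrite /tail -measureU//=; try exact: measurable_itv.
  congr (mu _); apply/seteqP; split => z /=; rewrite !in_itv/= !andbT.
    by move=> xz; case: (leP z (x + y)) => h; [left; rewrite xz|right].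
  by case=> [/andP[]//|]; apply: le_lt_trans; lra.
apply/seteqP; split => z //=; rewrite !in_itv/= !andbT => -[/andP[_ h1] h2].
lra.
Qed.

(** The identity that makes sums of [rho_density] along the walk telescope:
    h(x) = H(x) - E H(x + Y), written additively to stay clear of
    subtraction of extended reals. *)
Lemma rho_density_tail x :
  (rho_density mu x + \int[mu]_y tail (x + y)%R = tail x)%E.
Proof.
have mt : measurable_fun [set: S] (fun y => tail (x + y)).
  by apply: (measurableT_comp measurable_tail); exact: measurable_funD.
rewrite -integral_law_nneg//.
have mD : measurable (`[0, +oo[%classic : set S) by exact: measurable_itv.
have tx : (\int[mu]_(y in `[0%R, +oo[) tail x = tail x)%E.
  by rewrite integral_cst//= prob_nneg mule1.
rewrite -[RHS]tx.
rewrite /rho_density -ge0_integralD//=.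
- apply: eq_integral => y; rewrite inE/= in_itv/= andbT => y0.
  by rewrite -tail_split.
- have mB : measurable [set u : S * S | x < u.2 <= x + u.1].
    apply: measurable_set_of_pred; apply: measurable_and.
      by apply: measurable_fun_ltr => //; exact: measurable_snd.
    apply: measurable_fun_ler; first exact: measurable_snd.
    by apply: measurable_funD => //; exact: measurable_fst.
  have := measurable_fun_xsection mu mB.
  move/(measurable_funS measurableT) => h.
  have := h `[0, +oo[%classic (fun _ _ => I).
  congr measurable_fun; apply/funext => y /=; congr (mu _).
  by apply/seteqP; split => t; rewrite /xsection /= inE/= in_itv.
- exact: measurable_funTS.
Qed.

Lemma rho_density_le_tail x : (rho_density mu x <= tail x)%E.
Proof.
rewrite -[leRHS]rho_density_tail leeDl//.
by apply: integral_ge0 => y _; exact: tail_ge0.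
Qed.

(** With Y, Y' independent of law mu, this reads h(x) = P(x < Y <= x + Y');
    the first coordinate of the pair is Y'. *)
Lemma rho_density_prod x :
  rho_density mu x =
  product_law mu mu [set p : S * S | (0 <= p.1) && (x < p.2 <= x + p.1)].
Proof.
rewrite /rho_density integral_mkcond product_lawE; apply: eq_integral => y _ /=.
rewrite patchE; case: ifPn; rewrite ?inE ?notin_setE/= in_itv/= andbT => y0.
  congr (mu _); apply/seteqP; split => t; rewrite /xsection /= inE/= in_itv/=.
    by move=> ->; rewrite y0.
  by move=> /andP[].
rewrite (_ : xsection _ _ = set0) ?measure0//.
by apply/seteqP; split => t //; rewrite /xsection /= inE/= => /andP[].
Qed.

(** The complement of the support is null: it is covered by the rational
    balls of measure 0, which are countably many. *)
Lemma tail_above_Nsup x : (Nsup mu < x%:E)%E -> tail x = 0%E.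
Proof.
move=> xN.
pose cell (p : rat * rat) : set S :=
  if mu (ball (ratr p.1 : R) (ratr p.2)) == 0%E
  then ball (ratr p.1 : R) (ratr p.2) else set0.
pose cover n := if unpickle n is Some p then cell p else set0.
have cover0 : mu.-negligible (\bigcup_n cover n).
  apply: negligible_bigcup => n; rewrite /cover.
  case: unpickle => [p|]; last exact: negligible_set0.
  rewrite /cell; case: eqP => [p0|_]; last exact: negligible_set0.
  apply/negligibleP => //.
  exact: measurable_ball.
have xcover : `]x, +oo[%classic `<=` \bigcup_n cover n.
  move=> y /=; rewrite in_itv/= andbT => xy.
  have : ~ supp mu y.
    move=> sy; have yN : (y%:E <= Nsup mu)%E.
      exact: (@ereal_sup_ubound _ (EFin @` supp mu) _ (ex_intro2 _ _ y sy erefl)).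
    by have := le_lt_trans yN xN; rewrite lte_fin ltNge (ltW xy).
  move/existsNP => [U /not_implyP[oU /not_implyP[/mem_set Uy /negP]]].
  rewrite lt_neqAle measure_ge0 andbT negbK => /eqP U0.
  have [c [r [yb bU]]] := open_subball_rat oU Uy.
  (* y lies in a rational ball inside the null neighbourhood U *)
  have celly : cell (c, r) y.
    rewrite /cell [_ == _](_ : _ = true); first exact/set_mem.
    rewrite eq_le measure_ge0 andbT [leRHS]U0; apply: (le_measure mu _ _ bU); rewrite inE.
      exact: measurable_ball.
    exact: open_measurable.
  have cE : cover (pickle (c, r)) = cell (c, r) by rewrite /cover pickleK.
  by apply: (@bigcup_sup _ _ (pickle (c, r)) setT cover I); rewrite cE.
have tail_null : mu.-negligible `]x, +oo[%classic by apply: negligibleS cover0.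
by apply: measure_negligible => //; exact: measurable_itv.
Qed.

(** Why integrals of the density over the state space may be taken over the
    whole half-line. *)
Lemma rho_density_out x : 0 <= x -> ~ state_space mu x -> rho_density mu x = 0%E.
Proof.
move=> x0 xC; apply/eqP; rewrite eq_le rho_density_ge0 andbT.
rewrite (le_trans (rho_density_le_tail x))// tail_above_Nsup// ltNge.
by apply/negP => ?; apply: xC.
Qed.

Lemma one_minus_F x : 0 <= x -> (1 - Fmu mu x = tail x)%E.
Proof.
move=> x0; rewrite -prob_nneg.
rewrite (_ : `[0, +oo[%classic = `[0, x]%classic `|` `]x, +oo[%classic);
  last first.
  apply/seteqP; split => z /=; rewrite !in_itv/= !andbT.
    by move=> z0; case: (leP z x) => h; [left; rewrite z0|right].
  by case=> [/andP[]//|]; lra.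
rewrite measureU/=; [|exact: measurable_itv|exact: measurable_itv|]; last first.
  apply/seteqP; split => z //=; rewrite !in_itv/= !andbT => -[/andP[_ h1] h2].
  lra.
rewrite /Fmu addeAC subee ?add0e//.
by apply: fin_num_measure; exact: measurable_itv.
Qed.

End TailOfLaw.

(** * The mass of rho *)

Section MassOfRho.
Context {R : realType}.
Local Notation S := (measurableTypeR R).
Local Notation leb := (@lebesgue_measure R).
Variable mu : probability S R.
Hypothesis mu_nneg : mu `]-oo, 0[%classic = 0%E.

Lemma measurable_rho_region (A : set S) : measurable A ->
  measurable [set u : S * (S * S) |
    A u.1 /\ (0 <= u.2.1) && (u.1 < u.2.2 <= u.1 + u.2.1)].
Proof.
move=> mA.
have [m1 m2 m3] := @measurable_coords R.
apply: measurableI.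
  by rewrite -[X in measurable X]setTI; exact: (m1 measurableT).
apply: measurable_set_of_pred; apply: measurable_and.
  by apply: measurable_fun_ler.
apply: measurable_and; first exact: measurable_fun_ltr.
by apply: measurable_fun_ler => //; exact: measurable_funD.
Qed.

(** Slicing in the other direction: for each pair (Y', Y), the length of the
    set of positions x in A with x < Y <= x + Y'. *)
Lemma integral_rho_density (A : set S) : measurable A ->
  (\int[leb]_(x in A) rho_density mu x =
   \int[product_law mu mu]_p leb [set x | A x /\
     ((0 <= p.1) && (x < p.2 <= x + p.1))%R])%E.
Proof.
move=> mA; pose E := [set u : S * (S * S) |
    A u.1 /\ (0 <= u.2.1) && (u.1 < u.2.2 <= u.1 + u.2.1)].
have mE : measurable E by exact: measurable_rho_region.
transitivity (\int[leb]_x product_law mu mu (xsection E x))%E; last first.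
  rewrite (measure_section_swap leb (product_law mu mu) mE).
  apply: eq_integral => p _; congr (leb _).
  by apply/seteqP; split => x; rewrite /ysection/= inE.
rewrite integral_mkcond; apply: eq_integral => x _.
rewrite patchE; case: ifPn; rewrite ?inE ?notin_setE/= => Ax.
  rewrite rho_density_prod; congr (product_law mu mu _).
  by apply/seteqP; split => p; rewrite /xsection/= inE//= => -[].
rewrite (_ : xsection _ _ = set0) ?measure0//.
by apply/seteqP; split => p //; rewrite /xsection /= inE/= => -[].
Qed.

Lemma integral_rho_density_state_space (A : set S) :
  measurable A -> A `<=` [set x | 0 <= x] ->
  (\int[leb]_(x in A `&` state_space mu) rho_density mu x =
   \int[leb]_(x in A) rho_density mu x)%E.
Proof.
move=> mA A0; rewrite integral_mkcondr; apply: eq_integral => x.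
rewrite inE => Ax; rewrite patchE; case: ifPn => //; rewrite notin_setE => xC.
by rewrite rho_density_out//; exact: A0.
Qed.

(** For nonnegative (y', y), the slice of the region of [rho_density_prod] is
    the interval from max(0, y - y') to y, whose length is min(y', y), and the
    slice on the right-hand side is the interval from 0 to min(y', y).  When
    y' < 0 or y <= 0 both slices are empty. *)
Lemma rho_state_space :
  rho mu (state_space mu) =
  (\int[product_law mu mu]_p leb [set x | 0 <= x /\ (x < p.1) && (x < p.2)]%R)%E.
Proof.
have s0 : state_space mu `<=` `[0%R, +oo[%classic.
  by move=> x [x0 _]; rewrite /= in_itv/= x0.
rewrite /rho setIid -(setIidr s0) integral_rho_density_state_space//; last first.
  by move=> x; rewrite /= in_itv/= andbT.
rewrite integral_rho_density//; apply: eq_integral => -[y' y] _ /=.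
have [y'0|y'0] := leP 0 y'; last first.
  congr (leb _); apply/seteqP; split => x /=; rewrite in_itv/= andbT => -[x0]//.
  by move=> /andP[? _]; lra.
have [y0|y0] := leP y 0.
  congr (leb _); apply/seteqP; split => x /=; rewrite in_itv/= andbT => -[x0].
    by move=> /andP[? _]; lra.
  by move=> /andP[_ ?]; lra.
transitivity (leb `[Num.max 0 (y - y'), y[%classic).
  congr (leb _); apply/seteqP; split => x /=; rewrite !in_itv/= !andbT ge_max.
    by move=> [-> /andP[-> ?]]; rewrite andbT/=; lra.
  by move=> /andP[/andP[-> ?] ->]; split => //=; lra.
transitivity (leb `[0, Num.min y' y[%classic); last first.
  congr (leb _); apply/seteqP; split => x /=; rewrite !in_itv/= lt_min.
    by move=> /andP[-> ->].
  by move=> [-> ->].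
rewrite !lebesgue_measure_itv/= !lte_fin.
have -> : (Num.max 0 (y - y') < y) = (0 < Num.min y' y).
  by rewrite gt_max lt_min; apply/andP/andP => -[? ?]; split; lra.
case: ifPn => // _; rewrite -!EFinD; congr EFin.
by have [h|h] := leP y' y; have [h'|h'] := leP 0 (y - y'); lra.
Qed.

Lemma measurable_min_region : measurable [set u : S * (S * S) |
  0 <= u.1 /\ (u.1 < u.2.1) && (u.1 < u.2.2)].
Proof.
have [m1 m2 m3] := @measurable_coords R.
apply: measurableI; apply: measurable_set_of_pred.
  exact: measurable_fun_ler.
by apply: measurable_and; exact: measurable_fun_ltr.
Qed.

Lemma integral_tail_sq :
  (\int[leb]_(x in `[0%R, +oo[) (1 - Fmu mu x) ^+ 2 =
   \int[product_law mu mu]_p leb [set x | 0 <= x /\ (x < p.1) && (x < p.2)]%R)%E.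
Proof.
pose E := [set u : S * (S * S) |
    0 <= u.1 /\ (u.1 < u.2.1) && (u.1 < u.2.2)].
have mE : measurable E by exact: measurable_min_region.
transitivity (\int[leb]_x product_law mu mu (xsection E x))%E; last first.
  rewrite (measure_section_swap leb (product_law mu mu) mE).
  apply: eq_integral => p _; congr (leb _).
  by apply/seteqP; split => x; rewrite /ysection/= inE.
rewrite integral_mkcond; apply: eq_integral => x _.
rewrite patchE; case: ifPn; rewrite ?inE ?notin_setE/= in_itv/= andbT => x0.
  rewrite one_minus_F// (_ : xsection _ _ = `]x, +oo[%classic `*` `]x, +oo[%classic).
    by apply/esym/(product_measure1E mu mu); exact: measurable_itv.
  apply/seteqP; split => p; rewrite /xsection/= inE/= !in_itv/= !andbT.
    by move=> [_ /andP[]].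
  by move=> [xp1 xp2]; split => //; apply/andP.
rewrite (_ : xsection _ _ = set0) ?measure0//.
by apply/seteqP; split => p //; rewrite /xsection /= inE/= => -[].
Qed.

Lemma min_le_sqrtM (a b : R) :
  0 < a -> 0 < b -> Num.min a b <= Num.sqrt a * Num.sqrt b.
Proof.
move=> a0 b0; have m0 : 0 <= Num.min a b by rewrite le_min (ltW a0) (ltW b0).
rewrite -sqrtrM ?(ltW a0)// -[leLHS]ger0_norm// -sqrtr_sqr ler_wsqrtr// expr2.
by apply: ler_pM; rewrite // ge_min lexx ?orbT.
Qed.

(** Independence factors the integral of sqrt(y') sqrt(y), which dominates
    that of min(y', y). *)
Lemma integral_min_le_sqrt :
  (\int[product_law mu mu]_p leb [set x | 0 <= x /\ (x < p.1) && (x < p.2)]%R <=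
   (\int[mu]_(x in `[0%R, +oo[) (Num.sqrt x)%:E) ^+ 2)%E.
Proof.
have msqrt := continuous_measurable_fun (@sqrt_continuous R).
have msq : measurable_fun [set: S] (fun x : S => (Num.sqrt x)%:E).
  exact/measurable_EFinP.
rewrite integral_law_nneg//.
have m1 : measurable_fun [set: S * S] (fun p => Num.sqrt p.1 : R).
  exact: measurableT_comp msqrt measurable_fst.
have m2 : measurable_fun [set: S * S] (fun p => Num.sqrt p.2 : R).
  exact: measurableT_comp msqrt measurable_snd.
apply: (@le_trans _ _
    (\int[product_law mu mu]_p (Num.sqrt p.1 * Num.sqrt p.2)%:E)%E).
  apply: ge0_le_integral => //.
  - have := measurable_fun_ysection leb measurable_min_region.
    congr measurable_fun; apply/funext => p; congr (leb _).
    by apply/seteqP; split => x; rewrite /ysection/= inE.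
  - by apply/measurable_EFinP; exact: measurable_funM.
  - case=> y' y _ /=.
    rewrite (_ : [set x | _] = `[0, Num.min y' y[%classic); last first.
      apply/seteqP; split => x /=; rewrite !in_itv/= lt_min.
        by move=> [-> ->].
      by move=> /andP[-> ->].
    rewrite lebesgue_measure_itv/= lte_fin lt_min.
    case: ifPn => [/andP[y'0 y0]|_]; last first.
      by rewrite lee_fin mulr_ge0// sqrtr_ge0.
    by rewrite sube0 lee_fin; exact: min_le_sqrtM.
rewrite integral_product_law//; last first.
  by apply/measurable_EFinP; exact: measurable_funM.
rewrite le_eqVlt; apply/orP; left; apply/eqP.
rewrite expe2 -ge0_integralZr//; last exact: integral_ge0.
apply: eq_integral => x _; rewrite -ge0_integralZl// ?lee_fin ?sqrtr_ge0//.
Qed.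

End MassOfRho.

(** * Independence of the partial sums and the next increment *)

Section PartialSums.
Context d (T : measurableType d) (R : realType) (P : probability T R).
Local Notation S := (measurableTypeR R).
Variables (Y : nat -> {RV P >-> S}) (mu : probability S R).
Hypothesis Y_iid : iid Y mu.

Lemma measurable_sum_increments n :
  measurable_fun [set: T] (fun w => \sum_(0 <= i < n) Y i w : S).
Proof.
exact: (measurable_sum (index_iota 0 n) (fun i => measurable_funPT (Y i))).
Qed.

Definition psum n : {mfun T >-> S} :=
  HB.pack (fun w => \sum_(0 <= i < n) Y i w : S)
    (isMeasurableFun.Build _ _ _ _ _ (measurable_sum_increments n)).

Lemma psumE n w : psum n w = \sum_(0 <= i < n) Y i w. Proof. by []. Qed.

Lemma psumS n w : psum n.+1 w = psum n w + Y n w.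
Proof. by rewrite !psumE big_nat_recr. Qed.

Definition psum_law n : probability S R := distribution P (psum n).

Definition next_increment n : {mfun T >-> (S * S)%type} :=
  HB.pack (fun w => (psum n w : S, Y n w : S))
    (isMeasurableFun.Build _ _ _ _ _
       (measurable_fun_pair (measurable_funPT (psum n))
          (measurable_funPT (Y n)))).

Definition event (s : seq nat) (A : nat -> set S) : set T :=
  \bigcap_(i in [set` s]) (Y i @^-1` A i).

Lemma measurable_event s A : (forall i, measurable (A i)) -> measurable (event s A).
Proof.
move=> mA; rewrite /event; apply: fin_bigcap_measurable => // i _.
exact: measurable_funPTI.
Qed.

(** The event carried along concerns increments of index at least n; it is
    what lets the induction on n pass from S_n to S_n + Y_n. *)
Definition psum_indep n := forall s A B, uniq s -> all (leq n) s ->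
  (forall i, measurable (A i)) -> measurable B ->
  P ((psum n @^-1` B) `&` event s A) = (P (psum n @^-1` B) * P (event s A))%E.

Lemma event_cons n s A : event (n :: s) A = (Y n @^-1` A n) `&` event s A.
Proof.
rewrite /event; apply/seteqP; split => w /=.
  move=> h; split; first by apply: h; rewrite /= mem_head.
  by move=> i /= si; apply: h; rewrite /= inE si orbT.
by move=> [h1 h2] i /=; rewrite inE => /orP[/eqP->//|si]; exact: h2.
Qed.

Lemma prob_event_cons n s A : uniq (n :: s) -> (forall i, measurable (A i)) ->
  P (event (n :: s) A) = (mu (A n) * P (event s A))%E.
Proof.
move=> us mA; have [ind law] := Y_iid.
rewrite /event !ind//; last by move: us => /= /andP[].
by rewrite big_cons -(law n).
Qed.

(** Both sides are measures in E that agree on rectangles, by [psum_indep] for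
    the event with the n-th increment added.  Uniqueness of the product
    measure needs a normalised left-hand side, so the null case of the event
    is treated apart. *)
Lemma next_increment_indep n s A (E : set (S * S)) : psum_indep n ->
  uniq s -> all (leq n.+1) s -> (forall i, measurable (A i)) -> measurable E ->
  P ((next_increment n @^-1` E) `&` event s A) =
  (product_law (psum_law n) mu E * P (event s A))%E.
Proof.
move=> IH us sn mA mE; have mD := measurable_event s mA.
have nE : uniq (n :: s).
  by rewrite /= us andbT; apply/negP => /(allP sn); rewrite ltnn.
have [D0|D0] := eqVneq (P (event s A)) 0%E.
  rewrite D0 mule0; apply: subset_measure0 D0 => //.
  by apply: measurableI => //; exact: measurable_funPTI.
have Dfin : P (event s A) \is a fin_num by exact: fin_num_measure.
pose p := fine (P (event s A)).
have p0 : 0 < p.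
  by rewrite fine_gt0// lt_neqAle eq_sym D0 measure_ge0/= -ge0_fin_numE.
have pE : P (event s A) = p%:E by rewrite fineK.
have pV0 : 0 <= p^-1 by rewrite invr_ge0 ltW.
(* the law of the pair conditioned on the event *)
pose m0 := mscale (NngNum pV0) (pushforward (mrestr P mD) (next_increment n)).
pose m' := m0 (measurable_funPT (next_increment n)).
have rect B C : measurable B -> measurable C ->
    m' (B `*` C) = (psum_law n B * mu C)%E.
  move=> mB mC; rewrite /m' /m0 /mscale/= /pushforward /mrestr/=.
  pose A' i := if i == n then C else A i.
  have mA' i : measurable (A' i) by rewrite /A'; case: ifP.
  have eA' : event s A' = event s A.
    apply: eq_bigcapr => i /= si; rewrite /A'; case: eqP => // ni.
    by move: nE; rewrite /= -ni si.
  have -> : (next_increment n @^-1` (B `*` C)) `&` event s A =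
            (psum n @^-1` B) `&` event (n :: s) A'.
    rewrite event_cons eA' setIA; congr (_ `&` _).
    by rewrite /A' eqxx; apply/seteqP; split.
  rewrite IH//; last by rewrite /= leqnn; apply: sub_all sn => i /ltnW.
  rewrite prob_event_cons// eA' {1}/A' eqxx pE.
  by rewrite [X in (_ * X)%E]muleA muleCA -EFinM mulVf ?gt_eqF// mule1.
have mE' : product_law (psum_law n) mu E = m' E.
  exact: (product_measure_unique rect mE).
rewrite mE' /m' /m0 /mscale/= /pushforward /mrestr/=.
by rewrite pE muleAC -EFinM mulVf ?gt_eqF// mul1e.
Qed.

Lemma psum_indepP n : psum_indep n.
Proof.
elim: n => [|n IH] s A B us sn mA mB.
  have [B0|B0] := pselect (B 0).
    rewrite (_ : psum 0 @^-1` B = setT) ?setTI ?probability_setT ?mul1e//.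
    by apply/seteqP; split => w //= _; rewrite big_geq.
  rewrite (_ : psum 0 @^-1` B = set0) ?set0I ?measure0 ?mul0e//.
  by apply/seteqP; split => w //=; rewrite big_geq.
pose E := [set u : S * S | B (u.1 + u.2)].
have mE : measurable E.
  have madd : measurable_fun [set: S * S] (fun u => u.1 + u.2 : S).
    by apply: measurable_funD; [exact: measurable_fst|exact: measurable_snd].
  by rewrite -[X in measurable X]setTI; exact: madd.
have -> : psum n.+1 @^-1` B = next_increment n @^-1` E.
  by apply/seteqP; split => w; rewrite /preimage/E/= big_nat_recr.
rewrite next_increment_indep//; congr (_ * _)%E.
have e0 : event [::] A = setT by rewrite /event; apply/seteqP; split.
have := @next_increment_indep n [::] A E IH isT isT mA mE.
by rewrite e0 setIT probability_setT mule1.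
Qed.

Lemma next_increment_law n (E : set (S * S)) : measurable E ->
  P (next_increment n @^-1` E) = product_law (psum_law n) mu E.
Proof.
move=> mE; have e0 : event [::] (fun=> setT) = setT.
  by rewrite /event; apply/seteqP; split.
have := @next_increment_indep n [::] (fun=> setT) E (@psum_indepP n) isT isT
  (fun=> measurableT) mE.
by rewrite e0 setIT probability_setT mule1.
Qed.

(** Conditioning on S_n: the next increment is integrated out first. *)
Lemma expectation_next_increment n (f : S * S -> \bar R) :
  measurable_fun setT f -> (forall z, 0 <= f z)%E ->
  (\int[P]_w f (psum n w, Y n w) = \int[P]_w \int[mu]_y f (psum n w, y))%E.
Proof.
move=> mf f0.
transitivity (\int[distribution P (next_increment n)]_z f z)%E.
  by rewrite ge0_integral_distribution.
transitivity (\int[product_law (psum_law n) mu]_z f z)%E.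
  by apply: eq_measure_integral => E mE _; exact: next_increment_law.
rewrite integral_product_law// ge0_integral_distribution//.
- exact: measurable_fun_fubini_tonelli_F.
- by move=> x; apply: integral_ge0.
Qed.

End PartialSums.

(** * The renewal identity *)

Section Renewal.
Context d (T : measurableType d) (R : realType) (P : probability T R).
Local Notation S := (measurableTypeR R).
Variables (Y : nat -> {RV P >-> S}) (mu : probability S R).
Hypothesis Y_iid : iid Y mu.
Hypothesis Y_ge0 : forall n w, 0 <= Y n w.
Hypothesis Y_not0 : mu [set 0] != 1%E.

Lemma law_nneg : mu `]-oo, 0[%classic = 0%E.
Proof.
have [_ law] := Y_iid; rewrite -(law 0%N); last exact: measurable_itv.
rewrite /distribution /pushforward (_ : _ @^-1` _ = set0) ?measure0//.
by apply/seteqP; split => w //=; rewrite in_itv/= ltNge Y_ge0.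
Qed.

Lemma psum_ge0 n w : 0 <= psum Y n w.
Proof. by rewrite psumE; apply: sumr_ge0 => i _; exact: Y_ge0. Qed.

Lemma measurable_psum_shift n t (f : S -> \bar R) : measurable_fun setT f ->
  measurable_fun [set: T] (fun w => f (psum Y n w + t)).
Proof.
move=> mf; apply: (measurableT_comp mf).
by apply: measurable_funD => //; exact: (measurable_funPT (psum Y n)).
Qed.

Lemma renewal_step n t :
  (\int[P]_w rho_density mu (psum Y n w + t)%R +
   \int[P]_w tail mu (psum Y n.+1 w + t)%R =
   \int[P]_w tail mu (psum Y n w + t)%R)%E.
Proof.
pose f (z : S * S) := tail mu (z.1 + z.2 + t).
have mf : measurable_fun [set: S * S] f.
  apply: (measurableT_comp (measurable_tail mu)).
  apply: measurable_funD => //; apply: measurable_funD.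
    exact: measurable_fst.
  exact: measurable_snd.
have -> : (\int[P]_w tail mu (psum Y n.+1 w + t)%R =
    \int[P]_w \int[mu]_y tail mu (psum Y n w + t + y)%R)%E.
  transitivity (\int[P]_w f (psum Y n w, Y n w))%E.
    by apply: eq_integral => w _; rewrite psumS.
  rewrite (expectation_next_increment Y_iid n mf (fun z => tail_ge0 mu _)).
  by apply: eq_integral => w _; apply: eq_integral => y _; rewrite /f/= addrAC.
rewrite -ge0_integralD//.
- by apply: eq_integral => w _; rewrite (rho_density_tail law_nneg).
- by move=> w _; exact: rho_density_ge0.
- by apply: measurable_psum_shift; exact: measurable_rho_density.
- by move=> w _; apply: integral_ge0 => y _; exact: tail_ge0.
- pose g (z : S * S) := tail mu (z.1 + t + z.2).
  have mg : measurable_fun [set: S * S] g.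
    apply: (measurableT_comp (measurable_tail mu)).
    apply: measurable_funD; last exact: measurable_snd.
    by apply: measurable_funD => //; exact: measurable_fst.
  have mF := measurable_fun_fubini_tonelli_F (m2 := mu) g mg
    (fun z => tail_ge0 mu _).
  exact: (measurableT_comp mF (measurable_funPT (psum Y n))).
Qed.

Lemma renewal_partial_sum n t :
  (\sum_(0 <= k < n) \int[P]_w rho_density mu (psum Y k w + t)%R +
   \int[P]_w tail mu (psum Y n w + t)%R = tail mu t)%E.
Proof.
elim: n => [|n IH].
  rewrite big_geq// add0e.
  under eq_integral do rewrite psumE big_geq// add0r.
  exact: integral_probability_cst.
by rewrite big_nat_recr//= -addeA renewal_step.
Qed.

Definition laplace : \bar R := (\int[mu]_y (expR (- y))%:E)%E.

Lemma measurable_expRN : measurable_fun [set: S] (fun y : S => (expR (- y))%:E).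
Proof.
by apply/measurable_EFinP; apply: (measurableT_comp (@measurable_expR R)).
Qed.

Lemma laplace_ge0 : (0 <= laplace)%E.
Proof. by apply: integral_ge0 => y _; rewrite lee_fin expR_ge0. Qed.

(** 1 - exp(- y) is nonnegative on the half-line and vanishes only at 0, so
    its integral is zero only if mu is the point mass at 0. *)
Lemma laplace_lt1 : (laplace < 1)%E.
Proof.
(* the truncation at 0 only acts on negative y, a mu-null set; it makes the
   function nonnegative everywhere *)
pose g (y : S) := (Num.max 0 (1 - expR (- y)))%:E.
have mg : measurable_fun [set: S] g.
  apply/measurable_EFinP; apply: measurable_maxr => //.
  apply: measurable_funB => //.
  by apply: (measurableT_comp (@measurable_expR R)).
have g0 y : (0 <= g y)%E by rewrite lee_fin le_max lexx.
have mI : measurable (`[0, +oo[%classic : set S) by exact: measurable_itv.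
have split1 : (\int[mu]_y g y + laplace = 1)%E.
  rewrite /laplace -(integral_law_nneg law_nneg mg g0).
  rewrite -(integral_law_nneg law_nneg measurable_expRN); last first.
    by move=> y; rewrite lee_fin expR_ge0.
  rewrite -ge0_integralD//.
  - rewrite (eq_integral (cst 1%E)).
      by rewrite integral_cst//= mul1e prob_nneg// law_nneg.
    move=> y; rewrite inE/= in_itv/= andbT => y0.
    rewrite /g -EFinD; congr (_%:E).
    rewrite max_r ?subrK// subr_ge0 -expR0 ler_expR; lra.
  - exact: measurable_funTS.
  - by apply: measurable_funTS; exact: measurable_expRN.
have : (\int[mu]_y g y != 0)%E.
  apply/eqP => I0.
  have : (\int[mu]_y `|g y| = 0)%E.
    by rewrite -[RHS]I0; apply: eq_integral => y _; rewrite gee0_abs.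
  move/ae_eq_integral_abs => /(_ measurableT mg)[N [mN N0 gN]].
  move/eqP: Y_not0; apply.
  have -> : mu [set 0] = mu `[0, +oo[%classic; last by rewrite prob_nneg// law_nneg.
  apply/eqP; rewrite eq_le; apply/andP; split.
    apply: le_measure; rewrite ?inE//.
    by move=> y ->; rewrite /= in_itv/= lexx.
  apply: (@le_trans _ _ (mu ([set 0] `|` N))).
    apply: le_measure; rewrite ?inE//; first exact: measurableU.
    move=> y; rewrite /= in_itv/= andbT => y0.
    have [->|yn0] := eqVneq y 0; first by left.
    right; apply: gN => /= /(_ I); rewrite /g => -[] /eqP.
    rewrite max_r; last by rewrite subr_ge0 -expR0 ler_expR; lra.
    rewrite subr_eq0 -[X in X == _]expR0 eq_sym; apply/negP.
    by rewrite (inj_eq (@expR_inj R)) oppr_eq0.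
  by rewrite (@measureU0 _ _ _ mu)//.
move=> In0.
have I0 : (0 < \int[mu]_y g y)%E.
  by rewrite lt_neqAle eq_sym In0; apply: integral_ge0.
have lfin : laplace \is a fin_num.
  rewrite ge0_fin_numE ?laplace_ge0//.
  apply: (@le_lt_trans _ _ 1%E); rewrite ?ltry//.
  by rewrite -split1 leeDr// ltW.
by rewrite -[ltRHS]split1 lteDr.
Qed.

Lemma laplace_psum n :
  (\int[P]_w (expR (- psum Y n w))%:E = (fine laplace ^+ n)%:E)%E.
Proof.
have lfin : laplace \is a fin_num.
  by rewrite ge0_fin_numE ?laplace_ge0// (lt_trans laplace_lt1)// ltry.
elim: n => [|n IH].
  under eq_integral do rewrite psumE big_geq// oppr0 expR0.
  exact: integral_probability_cst.
pose f (z : S * S) := (expR (- z.1) * expR (- z.2))%:E.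
have mf : measurable_fun [set: S * S] f.
  apply/measurable_EFinP; apply: measurable_funM;
    apply: (measurableT_comp (@measurable_expR R)); apply: measurableT_comp => //.
transitivity (\int[P]_w f (psum Y n w, Y n w))%E.
  by apply: eq_integral => w _; rewrite psumS opprD expRD.
rewrite (expectation_next_increment Y_iid)//; last first.
  by move=> z; rewrite lee_fin mulr_ge0// expR_ge0.
transitivity (\int[P]_w ((expR (- psum Y n w))%:E * laplace))%E.
  apply: eq_integral => w _; rewrite /f/= /laplace -ge0_integralZl//.
  exact: measurable_expRN.
rewrite ge0_integralZr ?laplace_ge0//; last first.
  exact: (measurableT_comp measurable_expRN (measurable_funPT (psum Y n))).
by rewrite IH exprSr EFinM fineK.
Qed.

Lemma tail_small e : 0 < e -> exists K, (tail mu K <= e%:E)%E.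
Proof.
move=> e0; have idm : measurable_fun [set: S] (id : S -> R) by [].
pose X : {RV mu >-> R} :=
  HB.pack (id : S -> R) (isMeasurableFun.Build _ _ S R _ idm).
have /fine_cvgP[_ /cvgrPdist_le /(_ e e0)] := cvg_ccdfy0 X.
move=> [K [_ /(_ (K + 1))]]; rewrite ltrDl ltr01 => /(_ isT) /=.
rewrite sub0r normrN => h; exists (K + 1).
have tfin : tail mu (K + 1) \is a fin_num.
  by apply: fin_num_measure; exact: measurable_itv.
rewrite -[tail mu _]fineK// lee_fin; apply: le_trans h.
exact: ler_norm.
Qed.

(** H(s) <= e/2 + exp(K) exp(- s) for s >= 0, by H <= 1 below K and H <= e/2
    above K; the expectation of the second term at s = S_n decays
    geometrically. *)
Lemma tail_psum_small t e : 0 <= t -> 0 < e ->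
  exists n, (\int[P]_w tail mu (psum Y n w + t)%R <= e%:E)%E.
Proof.
move=> t0 e0; have e20 : 0 < e / 2 by rewrite divr_gt0.
have [K Ke] := tail_small e20.
pose phi := fine laplace.
have phi1 : `|phi| < 1.
  by rewrite ger0_norm ?fine_ge0 ?laplace_ge0// -lte_fin fineK ?laplace_lt1//
     ge0_fin_numE ?laplace_ge0// (lt_trans laplace_lt1)// ltry.
have [n phin] : exists n, expR K * phi ^+ n <= e / 2.
  have /cvgrPdist_le /(_ (e / 2 / expR K)) := cvg_expr phi1.
  rewrite divr_gt0 ?expR_gt0// => /(_ isT)[n _ /(_ n (leqnn n))].
  rewrite sub0r normrN => h; exists n.
  by rewrite mulrC -ler_pdivlMr ?expR_gt0// (le_trans _ h)// ler_norm.
exists n.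
have bound s : 0 <= s ->
    (tail mu s <= (e / 2)%:E + (expR K)%:E * (expR (- s))%:E)%E.
  move=> s0; have [Ks|sK] := leP K s.
    rewrite (le_trans (tail_nonincreasing mu Ks))// (le_trans Ke)// leeDl//.
  rewrite (le_trans (tail_le1 mu s))// -EFinM -expRD -EFinD lee_fin.
  have h1 : 1 <= expR (K - s) by rewrite -expR0 ler_expR subr_ge0 ltW.
  by rewrite (le_trans h1)// lerDr ltW.
have mE : measurable_fun [set: T] (fun w => (expR (- psum Y n w))%:E).
  exact: (measurableT_comp measurable_expRN (measurable_funPT (psum Y n))).
apply: (@le_trans _ _ (\int[P]_w
    ((e / 2)%:E + (expR K)%:E * (expR (- psum Y n w))%:E))%E).
  apply: ge0_le_integral => //.
  - by apply: measurable_psum_shift; exact: measurable_tail.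
  - by apply: emeasurable_funD => //; exact: emeasurable_funM.
  - move=> w _; apply: le_trans (bound _ (psum_ge0 n w)).
    by apply: tail_nonincreasing; rewrite lerDl.
have c0 : (0 <= (e / 2)%:E)%E by rewrite lee_fin ltW.
have ex0 w : (0 <= (expR (- psum Y n w))%:E)%E by rewrite lee_fin expR_ge0.
have mM : measurable_fun [set: T]
    (fun w => ((expR K)%:E * (expR (- psum Y n w))%:E)%E).
  exact: emeasurable_funM.
have cK : (0 <= (expR K)%:E)%E by rewrite lee_fin expR_ge0.
rewrite (@ge0_integralD _ _ _ P _ measurableT _ _ (fun w _ => c0)
  (measurable_cst _) (fun w _ => mule_ge0 cK (ex0 w)) mM).
rewrite integral_probability_cst.
rewrite (@ge0_integralZl _ _ _ P _ measurableT _ mE _ (fun w _ => ex0 w) cK).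
by rewrite laplace_psum -EFinM -EFinD lee_fin [leRHS]splitr lerD2l.
Qed.

(** The telescoping sum [renewal_partial_sum] with its vanishing remainder
    [tail_psum_small]. *)
Lemma renewal_identity t : 0 <= t ->
  (\sum_(n <oo) \int[P]_w rho_density mu (psum Y n w + t)%R = tail mu t)%E.
Proof.
move=> t0; have a0 n : (0 <= \int[P]_w rho_density mu (psum Y n w + t)%R)%E.
  by apply: integral_ge0 => w _; exact: rho_density_ge0.
have e0 n : (0 <= \int[P]_w tail mu (psum Y n w + t)%R)%E.
  by apply: integral_ge0 => w _; exact: tail_ge0.
apply/eqP; rewrite eq_le; apply/andP; split.
  apply: lime_le; first exact: is_cvg_nneseries.
  by apply: nearW => n; rewrite -(renewal_partial_sum n t) leeDl.
apply/lee_addgt0Pr => e epos; have [n ne] := tail_psum_small t0 epos.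
rewrite -(renewal_partial_sum n t); apply: leeD => //.
exact: nneseries_lim_ge.
Qed.

End Renewal.

(** * The first reflection along a trajectory *)

Section Overshoot.
Context {R : realType}.
Variables (y : nat -> R) (x : R).
Hypotheses (y_ge0 : forall n, 0 <= y n) (x_ge0 : 0 <= x).
Local Notation "'S_ n" := (\sum_(0 <= i < n) y i) (at level 8, n at level 2).

Lemma sum_increments_mono m n : (m <= n)%N -> 'S_ m <= 'S_ n.
Proof.
move=> mn; rewrite (big_cat_nat (leq0n m) mn)//= lerDl.
by apply: sumr_ge0 => i _; exact: y_ge0.
Qed.

Lemma reflected_walk_before n : 'S_ n <= x -> reflected_walk y x n = x - 'S_ n.
Proof.
elim: n => [|n IH]; first by rewrite big_geq// subr0.
move=> Sx /=; rewrite IH; last exact: le_trans (sum_increments_mono (leqnSn n)) Sx.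
by move: Sx; rewrite big_nat_recr//= => Sx; rewrite ger0_norm; lra.
Qed.

(** The first reflection occurs when the sums first reach x, and moves the
    walk to the overshoot.  At n = 0 the condition on the empty sum is weak
    because a reflection time is positive by definition: started at x = 0,
    the walk is reflected at time 1. *)
Lemma reflection_process1P z : reflection_process y x 1 = Some z <->
  exists n, [/\ 'S_ n < x ?<= if (n == 0%N), x <= 'S_ n.+1 & z = 'S_ n.+1 - x].
Proof.
have overshoot n : 'S_ n <= x -> x <= 'S_ n.+1 ->
    reflected_walk y x n.+1 = 'S_ n.+1 - x.
  move=> Sn; rewrite /= reflected_walk_before// big_nat_recr//= => Sn1.
  by rewrite ler0_norm; lra.
rewrite /reflection_process /= /first_time.
case: pselect => [ex|nex]; last first.
  split=> // -[n [_ xS _]]; exfalso; apply: nex; exists n.+1; exact: xS.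
case: ex_minnP => -[|n] //= xS minn; split.
  move=> [<-]; exists n; split => //.
    case: n xS minn => [|n] _ minn /=; first by rewrite big_geq.
    by rewrite ltNge; apply/negP => h; have := minn n.+1 h; rewrite ltnn.
  rewrite -overshoot//.
  case: n xS minn => [|n] _ minn /=; first by rewrite big_geq.
  by rewrite leNgt; apply/negP => /ltW h; have := minn n.+1 h; rewrite ltnn.
move=> [k [Skx xSk zE]].
have nk : (n <= k)%N by have := minn k.+1; rewrite xSk => /(_ isT).
have kn : (k <= n)%N.
  rewrite leqNgt; apply/negP => ltnk; move: Skx.
  rewrite gtn_eqF ?(leq_trans _ ltnk)//=.
  by rewrite ltNge (le_trans xS)// sum_increments_mono.
have -> : n = k by apply/eqP; rewrite eqn_leq nk kn.
rewrite zE; congr Some; apply: overshoot => //.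
by move: Skx; case: (k == 0%N) => //= /ltW.
Qed.

End Overshoot.

(** * Sigma-finiteness of rho *)

Section SigmaFiniteRho.
Context {R : realType}.
Local Notation S := (measurableTypeR R).
Local Notation leb := (@lebesgue_measure R).
Variable mu : probability S R.

Lemma rho_density_le1 x : (rho_density mu x <= 1)%E.
Proof.
rewrite rho_density_prod; apply: probability_le1.
apply: measurable_set_of_pred; apply: measurable_and.
  by apply: measurable_fun_ler => //; exact: measurable_fst.
apply: measurable_and.
  by apply: measurable_fun_ltr => //; exact: measurable_snd.
apply: measurable_fun_ler; first exact: measurable_snd.
by apply: measurable_funD => //; exact: measurable_fst.
Qed.

Lemma rho_sigma_finite : sigma_finite setT (rho mu).
Proof.
exists (fun n => `]- n%:R, n%:R[%classic).
  apply/seteqP; split => // x _; exists (Num.bound `|x|) => //=.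
  by rewrite in_itv/= -ltr_norml archi_boundP.
move=> n; split; first exact: measurable_itv.
have mI : measurable (`](- n%:R : R), n%:R[%classic `&` state_space mu : set S).
  by apply: measurableI; [exact: measurable_itv|exact: measurable_state_space].
apply: (@le_lt_trans _ _ (leb (`](- n%:R : R), n%:R[%classic `&` state_space mu))).
  rewrite -[leRHS]mul1e -integral_cst// /rho; apply: ge0_le_integral => //.
  - by move=> x _; exact: rho_density_ge0.
  - by apply: measurable_funTS; exact: measurable_rho_density.
  - by move=> x _; exact: rho_density_le1.
apply: (@le_lt_trans _ _ (leb `](- n%:R : R), n%:R[%classic)).
  apply: le_measure; rewrite ?inE//.
by rewrite lebesgue_measure_itv/=; case: ifP; rewrite ?ltry// -EFinB ltry.
Qed.

HB.instance Definition _ :=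
  Measure_isSigmaFinite.Build _ _ _ (rho mu) rho_sigma_finite.

End SigmaFiniteRho.

(** * Invariance of rho *)

Section FirstPassage.
Context d (T : measurableType d) (R : realType) (P : probability T R).
Local Notation S := (measurableTypeR R).
Local Notation leb := (@lebesgue_measure R).
Variables (Y : nat -> {RV P >-> S}) (mu : probability S R).
Hypothesis Y_iid : iid Y mu.
Hypothesis Y_ge0 : forall n w, 0 <= Y n w.
Hypothesis Y_not0 : mu [set 0] != 1%E.
Variable A : set S.
Hypothesis mA : measurable A.
Hypothesis A_sub : A `<=` state_space mu.

Let mu_nneg := law_nneg Y_iid Y_ge0.

Let A_ge0 z : A z -> 0 <= z. Proof. by move=> /A_sub[]. Qed.

(** A point (x, (u, y)) stands for the starting position x, the sum u of the
    first n increments and the next increment y; membership says that the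
    walk is first reflected at step n + 1, into A. *)
Definition first_passage n : set (S * (S * S)) := [set v |
  [/\ state_space mu v.1, A (v.2.1 + v.2.2 - v.1), 0 <= v.2.1 &
      v.2.1 < v.1 ?<= if (n == 0%N)]].

Lemma measurable_first_passage n : measurable (first_passage n).
Proof.
have [m1 m2 m3] := @measurable_coords R.
have -> : first_passage n =
    ([set v | state_space mu v.1] `&` [set v | A (v.2.1 + v.2.2 - v.1)]) `&`
    ([set v | 0 <= v.2.1] `&` [set v | v.2.1 < v.1 ?<= if (n == 0%N)]).
  by apply/seteqP; split => v /= [] => [? ? ? ?|[? ?] [? ?]].
apply: measurableI; apply: measurableI.
- rewrite -[X in measurable X]setTI; apply: (m1 measurableT).
  exact: measurable_state_space.
- have mc : measurable_fun [set: S * (S * S)] (fun u => u.2.1 + u.2.2 - u.1 : S).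
    by apply: measurable_funB => //; exact: measurable_funD.
  by rewrite -[X in measurable X]setTI; exact: (mc measurableT).
- by apply: measurable_set_of_pred; exact: measurable_fun_ler.
- apply: measurable_set_of_pred; case: (n == 0%N) => /=.
    exact: measurable_fun_ler.
  exact: measurable_fun_ltr.
Qed.

(** The step at which the first reflection occurs splits the event into
    disjoint pieces: after a passage at step n + 1 all later sums are at least
    x. *)
Lemma reflection_kernel_series x : state_space mu x ->
  reflection_kernel Y x A =
  (\sum_(n <oo) product_law (psum_law Y n) mu (xsection (first_passage n) x))%E.
Proof.
move=> Cx; have x0 : 0 <= x by case: Cx.
pose F n := next_increment Y n @^-1` xsection (first_passage n) x.
have mF n : measurable (F n).
  apply: measurable_funPTI; apply: measurable_xsection.
  exact: measurable_first_passage.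
have FE n w : F n w <->
    psum Y n w < x ?<= if (n == 0%N) /\ A (psum Y n.+1 w - x).
  rewrite /F /preimage/= /xsection/= inE/= big_nat_recr//=.
  split => [[]//|[h1 h2]].
  by split => //; exact: psum_ge0.
have -> : reflection_kernel Y x A = P (\bigcup_n F n).
  rewrite /reflection_kernel; congr (P _); apply/seteqP; split => w /=.
    move=> [z /(reflection_process1P (fun n => Y_ge0 n w) x0)[n [h1 h2 ->]] Az].
    by exists n => //; apply/FE.
  move=> [n _ /FE[h1 h2]]; exists (psum Y n.+1 w - x) => //.
  apply/(reflection_process1P (fun n => Y_ge0 n w) x0); exists n; split => //.
  by rewrite -subr_ge0; exact: A_ge0.
rewrite measure_bigcup//; last first.
  apply/trivIsetP => i j _ _; wlog ij : i j / (i < j)%N.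
    move=> h; rewrite neq_ltn => /orP[ij|ji].
      by apply: h; rewrite // neq_ltn ij.
    by rewrite setIC; apply: h; rewrite // neq_ltn ji.
  move=> _; apply/seteqP; split => w //= -[/FE[_ /A_ge0 h1] /FE[h2 _]].
  move: h2; rewrite gtn_eqF ?(leq_trans _ ij)//= ltNge => /negP; apply.
  rewrite -subr_ge0 (le_trans h1)// lerD2r.
  exact: (sum_increments_mono (fun n => Y_ge0 n w)).
transitivity (\sum_(n <oo) P (F n))%E.
  by apply: eq_eseriesl => n; rewrite in_setT.
apply: eq_eseriesr => n _; rewrite -(next_increment_law Y_iid)//.
by apply: measurable_xsection; exact: measurable_first_passage.
Qed.

(** [first_passage] in terms of the landing point s = u + y - x instead of x;
    a point is ((u, y), s).  The inequality u < x becomes s < y. *)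
Definition passage_region : set ((S * S) * S) := [set v |
  [/\ A v.2, 0 <= v.1.1 & v.2 < v.1.2]].

Lemma measurable_passage_region : measurable passage_region.
Proof.
have m1 : measurable_fun [set: (S * S) * S] (fun u => u.1.1 : S).
  exact: measurableT_comp measurable_fst measurable_fst.
have m2 : measurable_fun [set: (S * S) * S] (fun u => u.1.2 : S).
  exact: measurableT_comp measurable_snd measurable_fst.
have m3 : measurable_fun [set: (S * S) * S] (fun u => u.2 : S) by exact: measurable_snd.
have -> : passage_region = [set v | A v.2] `&`
    ([set v | 0 <= v.1.1] `&` [set v | v.2 < v.1.2]).
  by apply/seteqP; split => v /= [] => [? ? ?|? [? ?]].
apply: measurableI; last apply: measurableI.
- by rewrite -[X in measurable X]setTI; exact: (m3 measurableT).
- by apply: measurable_set_of_pred; exact: measurable_fun_ler.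
- by apply: measurable_set_of_pred; exact: measurable_fun_ltr.
Qed.

(** The substitution s = u + y - x preserves Lebesgue measure.  The point
    x = u, present on the left only for n = 0, is negligible, and so is the
    restriction to the state space, off which the density vanishes. *)
Lemma rho_first_passage n u y :
  rho mu (ysection (first_passage n) (u, y)) =
  (\int[leb]_s ((\1_passage_region ((u, y), s))%:E *
                rho_density mu (u + y - s)))%E.
Proof.
have [u0|u0] := leP 0 u; last first.
  rewrite (_ : ysection _ _ = set0); last first.
    apply/seteqP; split => x //; rewrite /ysection/= inE/= => -[_ _].
    by rewrite leNgt u0.
  rewrite measure0 integral0_eq// => s _.
  rewrite indicE memNset ?mul0e// => -[_ /=].
  by rewrite leNgt u0.
pose B' := [set x : S | A (u + y - x) /\ u < x].
have mB' : measurable B'.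
  apply: measurableI.
    have mc : measurable_fun [set: S] (fun x => u + y - x : S).
      by apply: measurable_funB.
    by rewrite -[X in measurable X]setTI; exact: (mc measurableT).
  by apply: measurable_set_of_pred; exact: measurable_fun_ltr.
have mI : measurable (B' `&` state_space mu).
  by apply: measurableI => //; exact: measurable_state_space.
transitivity (\int[leb]_(x in B') rho_density mu x)%E.
  rewrite -integral_rho_density_state_space//; last first.
    by move=> x [_ /ltW]; exact: le_trans.
  rewrite /rho.
  have -> : ysection (first_passage n) (u, y) `&` state_space mu =
            ysection (first_passage n) (u, y).
    by apply/seteqP; split => [x []//|x]; rewrite /ysection/= inE => -[].
  have yE : ysection (first_passage n) (u, y) `\ u = B' `&` state_space mu.
    apply/seteqP; split => x; rewrite /ysection/= inE/=.
      move=> [[Cx Ax _ ux] /eqP xu]; split => //; split => //.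
      by rewrite lt_neqAle eq_sym xu/=; move: ux; case: (n == 0%N) => //= /ltW.
    move=> [[Ax ux] Cx]; split; last by move=> xu; move: ux; rewrite xu ltxx.
    by split => //; case: (n == 0%N) => //=; exact: ltW.
  rewrite -(@integral_setD1 _ _ u) yE//.
  by apply: measurable_funTS; exact: measurable_rho_density.
transitivity (\int[leb]_x ((\1_B' x)%:E * rho_density mu x))%E.
  rewrite integral_mkcond; apply: eq_integral => x _; rewrite patchE indicE.
  by case: ifP => _; rewrite ?mul1e ?mul0e.
rewrite -(ge0_integral_reflection (u + y)); last 2 first.
- apply: emeasurable_funM; last exact: measurable_rho_density.
  by apply/measurable_EFinP; exact: measurable_indic.
- by move=> x; rewrite mule_ge0 ?rho_density_ge0// lee_fin.
apply: eq_integral => s _; congr (_%:E * _)%E.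
rewrite !indicE; congr ((nat_of_bool _)%:R); apply/idP/idP;
  rewrite !inE /B' /passage_region/=.
  by rewrite subKr => -[? ?]; split => //; lra.
by rewrite subKr => -[? _ ?]; split => //; lra.
Qed.

Definition passage_density (v : (S * S) * S) : \bar R :=
  ((\1_passage_region v)%:E * rho_density mu (v.1.1 + v.1.2 - v.2))%E.

Lemma passage_density_ge0 v : (0 <= passage_density v)%E.
Proof. by rewrite mule_ge0 ?rho_density_ge0// lee_fin. Qed.

Lemma measurable_passage_density : measurable_fun setT passage_density.
Proof.
apply: emeasurable_funM.
  apply/measurable_EFinP; apply: measurable_indic.
  exact: measurable_passage_region.
apply: (measurableT_comp (measurable_rho_density mu)).
apply: measurable_funB; last exact: measurable_snd.
by apply: measurable_funD; [exact: measurableT_comp measurable_fst measurable_fst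
  |exact: measurableT_comp measurable_snd measurable_fst].
Qed.

(** Just before an increment y that lands at s, the walk is at the height
    y - s > 0; the renewal identity is applied at this height. *)
Definition landing_region : set (S * S) := [set z | A z.1 /\ z.1 < z.2].

Lemma measurable_landing_region : measurable landing_region.
Proof.
apply: measurableI.
  by rewrite -[X in measurable X]setTI; exact: (@measurable_fst _ _ S S measurableT).
apply: measurable_set_of_pred; apply: measurable_fun_ltr.
  exact: measurable_fst.
exact: measurable_snd.
Qed.

Definition visit_density n (z : S * S) : \bar R :=
  ((\1_landing_region z)%:E *
   \int[P]_w rho_density mu (psum Y n w + (z.2 - z.1))%R)%E.

Lemma visit_density_ge0 n z : (0 <= visit_density n z)%E.
Proof.
rewrite mule_ge0// ?lee_fin//.
by apply: integral_ge0 => w _; exact: rho_density_ge0.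
Qed.

Lemma measurable_visit_density n : measurable_fun setT (visit_density n).
Proof.
apply: emeasurable_funM.
  apply/measurable_EFinP; apply: measurable_indic.
  exact: measurable_landing_region.
pose f (q : (S * S) * T) := rho_density mu (psum Y n q.2 + (q.1.2 - q.1.1)).
have mf : measurable_fun setT f.
  apply: (measurableT_comp (measurable_rho_density mu)).
  apply: measurable_funD.
    exact: (measurableT_comp (measurable_funPT (psum Y n)) measurable_snd).
  apply: measurable_funB.
    exact: measurableT_comp measurable_snd measurable_fst.
  exact: measurableT_comp measurable_fst measurable_fst.
exact: (measurable_fun_fubini_tonelli_F (m2 := P) f mf
  (fun q => rho_density_ge0 mu _)).
Qed.

(** The n-th term of the kernel integrated against rho: exchange the order of
    integration, pass to the landing point s, and keep the increment y
    outside the expectation over the sum. *)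
Lemma integral_first_passage n :
  (\int[rho mu]_x product_law (psum_law Y n) mu (xsection (first_passage n) x) =
   \int[leb \x mu]_z visit_density n z)%E.
Proof.
rewrite (measure_section_swap (rho mu) (product_law (psum_law Y n) mu)
  (measurable_first_passage n)).
transitivity (\int[product_law (psum_law Y n) mu]_v
    \int[leb]_s passage_density (v, s))%E.
  by apply: eq_integral => -[u y] _; exact: rho_first_passage.
rewrite (fubini_tonelli (m1 := product_law (psum_law Y n) mu) (m2 := leb)
  passage_density measurable_passage_density passage_density_ge0).
rewrite (fubini_tonelli1 (m1 := leb) (m2 := mu) (visit_density n)
  (measurable_visit_density n) (visit_density_ge0 n)).
apply: eq_integral => s _.
pose f (v : S * S) := passage_density (v, s).
have mf : measurable_fun setT f.
  by apply: measurable_fun_pair1; exact: measurable_passage_density.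
have f0 v : (0 <= f v)%E by exact: passage_density_ge0.
rewrite [LHS](fubini_tonelli2 (m1 := psum_law Y n) (m2 := mu) f mf f0).
apply: eq_integral => y _; rewrite /fubini_G.
rewrite ge0_integral_distribution//; last first.
  exact: (@measurable_fun_pair1 _ _ _ _ _ _ f y mf).
have mh := measurable_psum_shift Y n (y - s) (measurable_rho_density mu).
have ind0 : (0 <= (\1_landing_region (s, y) : R)%:E)%E by rewrite lee_fin.
rewrite /visit_density -(@ge0_integralZl _ _ _ P _ measurableT _ mh _
  (fun w _ => rho_density_ge0 mu _) ind0).
apply: eq_integral => w _; rewrite /f /passage_density/= addrA.
congr (_%:E * _)%E; rewrite !indicE; congr ((nat_of_bool _)%:R).
apply/idP/idP; rewrite !inE /passage_region /landing_region/=.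
  by case.
by case=> ? ?; split => //; exact: psum_ge0.
Qed.

(** The left-hand side is the integral over s in A of P(s < Y < s + Y'), the
    right-hand side that of P(s < Y <= s + Y').  For given (Y', Y) the only
    point that distinguishes them is s = Y - Y'. *)
Lemma integral_landing :
  (\int[leb \x mu]_z ((\1_landing_region z)%:E * tail mu (z.2 - z.1)%R) =
   rho mu A)%E.
Proof.
pose E := [set v : S * (S * S) |
  A v.1 /\ (v.1 < v.2.2) && (v.2.2 < v.1 + v.2.1)].
have [m1 m2 m3] := @measurable_coords R.
have mE : measurable E.
  apply: measurableI.
    by rewrite -[X in measurable X]setTI; exact: (m1 measurableT).
  apply: measurable_set_of_pred; apply: measurable_and.
    exact: measurable_fun_ltr.
  by apply: measurable_fun_ltr => //; exact: measurable_funD.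
pose g (z : S * S) := ((\1_landing_region z)%:E * tail mu (z.2 - z.1)%R)%E.
have mg : measurable_fun setT g.
  apply: emeasurable_funM.
    apply/measurable_EFinP; apply: measurable_indic.
    exact: measurable_landing_region.
  apply: (measurableT_comp (measurable_tail mu)).
  by apply: measurable_funB; [exact: measurable_snd|exact: measurable_fst].
have g0 z : (0 <= g z)%E by rewrite mule_ge0 ?tail_ge0// lee_fin.
rewrite (fubini_tonelli1 (m1 := leb) (m2 := mu) g mg g0).
transitivity (\int[leb]_s product_law mu mu (xsection E s))%E.
  apply: eq_integral => s _; rewrite /fubini_F product_lawE.
  rewrite (measure_section_swap mu mu (measurable_xsection s mE)).
  apply: eq_integral => y _; rewrite /g indicE.
  case: (boolP ((s, y) \in landing_region)); rewrite ?inE ?notin_setE => h.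
    rewrite mul1e /tail; congr (mu _); apply/seteqP; split => y'.
      rewrite /= in_itv/= andbT => yy; case: h => /= As sy.
      do 2 apply/mem_set => /=.
      by split => //; apply/andP; split => //=; lra.
    move=> /set_mem/= /set_mem/= [_ /andP[_ /= ?]].
    by rewrite in_itv/= andbT; lra.
  rewrite mul0e (_ : ysection _ _ = set0) ?measure0//.
  apply/seteqP; split => y' // /set_mem/= /set_mem/= [As /andP[sy _]].
  by apply: h.
rewrite (measure_section_swap leb (product_law mu mu) mE).
rewrite /rho (setIidl A_sub) integral_rho_density//.
apply: eq_integral => -[y' y] _ /=.
have mp : measurable (ysection [set u : S * (S * S) |
    A u.1 /\ (0 <= u.2.1) && (u.1 < u.2.2 <= u.1 + u.2.1)] (y', y)).
  by apply: measurable_ysection; exact: measurable_rho_region.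
have mq : measurable (ysection E (y', y)) by exact: measurable_ysection.
apply: (lebesgue_measure_add_point (a := y - y')) => //.
- move: mp; congr measurable; apply/seteqP.
  by split => s; rewrite /ysection/= inE.
- move=> s; rewrite /ysection/= inE/= => -[As /andP[/= h1 h2]]; split => //.
  apply/and3P; split => //; last exact: ltW.
  by have := lt_trans h1 h2; rewrite ltrDl => /ltW.
- move=> s [As /and3P[h0 h1 h2]].
  have [->|/eqP ne] := eqVneq s (y - y'); [by right|left].
  rewrite /ysection/= inE/=; split => //; rewrite h1/= lt_neqAle h2 andbT.
  by apply/eqP => h; apply: ne; rewrite h; lra.
Qed.

(** The series over n is summed inside the integral over (s, y), where it is
    the renewal identity at the height y - s. *)
Lemma integral_reflection_kernel :
  (\int[rho mu]_(x in state_space mu) reflection_kernel Y x A = rho mu A)%E.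
Proof.
transitivity (\int[rho mu]_x \sum_(n <oo)
    product_law (psum_law Y n) mu (xsection (first_passage n) x))%E.
  rewrite integral_mkcond; apply: eq_integral => x _; rewrite patchE.
  case: ifPn; rewrite ?inE ?notin_setE => Cx.
    exact: reflection_kernel_series.
  rewrite eseries0// => n _ _; rewrite (_ : xsection _ _ = set0) ?measure0//.
  by apply/seteqP; split => v //; rewrite /xsection/= inE => -[].
rewrite integral_nneseries//; last first.
  move=> n; exact: (measurable_fun_xsection (product_law (psum_law Y n) mu)
    (measurable_first_passage n)).
rewrite (eq_eseriesr (fun n _ => integral_first_passage n)).
rewrite -integral_nneseries//; last 2 first.
- by move=> n; exact: measurable_visit_density.
- by move=> n z _; exact: visit_density_ge0.
rewrite -integral_landing; apply: eq_integral => z _.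
rewrite /visit_density indicE; case: (boolP (z \in landing_region)).
  rewrite inE => -[_ z12]; rewrite mul1e -(renewal_identity Y_iid)//.
    by apply: eq_eseriesr => n _; rewrite mul1e.
  by rewrite subr_ge0 ltW.
by move=> _; rewrite mul0e eseries0// => n _ _; rewrite mul0e.
Qed.

End FirstPassage.

Theorem mainTheorem5 (R : realType) (d : measure_display)
  (T : measurableType d) (P : probability T R)
  (Y : nat -> {RV P >-> measurableTypeR R})
  (mu : probability (measurableTypeR R) R)
  (Y_iid : iid Y mu)
  (Y_ge0 : forall n w, 0 <= Y n w)
  (Y_nonconstant : forall c : R, mu [set c] != 1%E)
  (nonlattice : ~ lattice mu) :
  [/\ invariant_measure (state_space mu) (reflection_kernel Y) (rho mu),
      (rho mu (state_space mu) < +oo)%E <->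
        (\int[lebesgue_measure]_(x in `[0%R, +oo[) (1 - Fmu mu x) ^+ 2 < +oo)%E,
      'E_P[fun w => Num.sqrt (Y 0%N w)]%E
        = (\int[mu]_(x in `[0%R, +oo[) (Num.sqrt x)%:E)%E
    & (\int[mu]_(x in `[0%R, +oo[) (Num.sqrt x)%:E < +oo)%E ->
        (rho mu (state_space mu) < +oo)%E].
Proof.
have mu_nneg := law_nneg Y_iid Y_ge0.
split.
- move=> A mA AC.
  exact: (integral_reflection_kernel Y_iid Y_ge0 (Y_nonconstant 0) mA AC).
- by rewrite rho_state_space// integral_tail_sq.
- have msq : measurable_fun [set: measurableTypeR R]
      (fun x : measurableTypeR R => (Num.sqrt x)%:E).
    apply/measurable_EFinP.
    exact: (continuous_measurable_fun (@sqrt_continuous R)).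
  have sq0 (x : R) : (0 <= (Num.sqrt x)%:E)%E by rewrite lee_fin sqrtr_ge0.
  rewrite unlock integral_law_nneg//.
  rewrite -(ge0_integral_distribution (Y 0%N) msq)//.
  apply: eq_measure_integral => A mA _; have [_ law] := Y_iid.
  exact: law.
- move=> sqfin; rewrite rho_state_space//.
  apply: (le_lt_trans (integral_min_le_sqrt mu_nneg)).
  by rewrite expe2 lte_mul_pinfty// ?ge0_fin_numE//; apply: integral_ge0.
Qed.
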